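(* Let $L$ be a finite-dimensional Lie algebra over $\mathbb{F}$, and let $I$ be a perfect ideal of $L$. If the factor algebra $L/I$ is perfect, then $L$ is a perfect Lie algebra.
   Context: $\mathbb{F}$ denotes either the field of real numbers or the field of complex numbers. A Lie algebra $M$ is called perfect if $[M,M]=M$, where $[M,M]$ is the linear span of all brackets of elements of $M$ (the zero Lie algebra is perfect). An ideal $I$ of $L$ is called a perfect ideal if $I$ is itself a perfect Lie algebra, i.e. $[I,I]=I$. The factor algebra $L/I$ is the quotient vector space with bracket $[x+I,y+I]=[x,y]+I$. *)

(* Defs.v *)
From HB Require Import structures.
From mathcomp Require Import all_boot all_order all_algebra.
From mathcomp Require Import generic_quotient ring_quotient.
From mathcomp Require Import boolp classical_sets reals.
From mathcomp Require Import complex.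

Set Implicit Arguments.
Unset Strict Implicit.
Unset Printing Implicit Defensive.

Import GRing.Theory.
Local Open Scope ring_scope.
Local Open Scope classical_set_scope.
Local Open Scope quotient_scope.

Variant real_or_complex : fieldType -> Prop :=
| RealScalars (R : realType) : real_or_complex R
| ComplexScalars (R : realType) : real_or_complex R[i].

HB.mixin Record isLieAlgebra (F : fieldType) L of GRing.Lmodule F L := {
  lieb : L -> L -> L;
  lieb_linearl : forall y, linear (fun x => lieb x y);
  lieb_linearr : forall x, linear (lieb x);
  liebxx : forall x, lieb x x = 0;
  lieb_jacobi : forall x y z,
    lieb x (lieb y z) + lieb y (lieb z x) + lieb z (lieb x y) = 0
}.

#[short(type="lieAlgType")]
HB.structure Definition LieAlgebra (F : fieldType) :=
  {L of isLieAlgebra F L & GRing.Lmodule F L}.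

#[short(type="finDimLieAlgType")]
HB.structure Definition FinDimLieAlgebra (F : fieldType) :=
  {L of LieAlgebra F L & Vector F L}.

Definition linear_span (F : fieldType) (V : lmodType F) (A : set V) : set V :=
  [set x | exists (n : nat) (a : 'I_n -> F) (v : 'I_n -> V),
      (forall i, A (v i)) /\ x = \sum_(i < n) a i *: v i].

Definition lie_derived (F : fieldType) (M : lieAlgType F) : set M :=
  linear_span [set z | exists x y : M, z = lieb x y].

Arguments lie_derived {F} M _.

Definition lie_perfect (F : fieldType) (M : lieAlgType F) : Prop :=
  lie_derived M = [set: M].

Section LieBracketTheory.
Variables (F : fieldType) (L : lieAlgType F).
Implicit Types x y z : L.

Lemma liebDl x y z : lieb (x + y) z = lieb x z + lieb y z.
Proof. by have := lieb_linearl z 1 x y; rewrite !scale1r. Qed.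

Lemma liebDr x y z : lieb x (y + z) = lieb x y + lieb x z.
Proof. by have := lieb_linearr x 1 y z; rewrite !scale1r. Qed.

Lemma lieb0l x : lieb 0 x = 0.
Proof. by apply: (addrI (lieb 0 x)); rewrite -liebDl !addr0. Qed.

Lemma lieb0r x : lieb x 0 = 0.
Proof. by apply: (addrI (lieb x 0)); rewrite -liebDr !addr0. Qed.

Lemma liebZl a x y : lieb (a *: x) y = a *: lieb x y.
Proof. by have := lieb_linearl y a x 0; rewrite !addr0 lieb0l addr0. Qed.

Lemma liebZr a x y : lieb x (a *: y) = a *: lieb x y.
Proof. by have := lieb_linearr x a y 0; rewrite !addr0 lieb0r addr0. Qed.

Lemma liebC x y : lieb x y = - lieb y x.
Proof.
apply/eqP; rewrite -addr_eq0; apply/eqP.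
by have := liebxx (x + y); rewrite liebDl !liebDr !liebxx add0r addr0.
Qed.

Lemma liebBl x y z : lieb (x - y) z = lieb x z - lieb y z.
Proof. by rewrite liebDl -scaleN1r liebZl scaleN1r. Qed.

Lemma liebBr x y z : lieb x (y - z) = lieb x y - lieb x z.
Proof. by rewrite liebDr -scaleN1r liebZr scaleN1r. Qed.

End LieBracketTheory.

(* Left and right ideals coincide, since the bracket is antisymmetric. *)
Record lie_ideal (F : fieldType) (L : finDimLieAlgType F) := LieIdeal {
  lie_ideal_space :> {vspace L};
  lie_idealP : forall x u, u \in lie_ideal_space -> lieb x u \in lie_ideal_space
}.

Section IdealAsLieAlgebra.
Variables (F : fieldType) (L : finDimLieAlgType F) (I : lie_ideal L).

Definition lie_sub : Type := subvs_of I.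
HB.instance Definition _ := Vector.on lie_sub.

Definition lie_sub_bracket (u v : lie_sub) : lie_sub :=
  Subvs (lie_idealP (vsval u) (subvsP v)).

Fact lie_sub_linearl v : linear (fun u => lie_sub_bracket u v).
Proof. by move=> a u w; apply: val_inj => /=; rewrite liebDl liebZl. Qed.

Fact lie_sub_linearr u : linear (lie_sub_bracket u).
Proof. by move=> a v w; apply: val_inj => /=; rewrite liebDr liebZr. Qed.

Fact lie_subxx u : lie_sub_bracket u u = 0.
Proof. by apply: val_inj; rewrite /= liebxx. Qed.

Fact lie_sub_jacobi u v w :
  lie_sub_bracket u (lie_sub_bracket v w)
  + lie_sub_bracket v (lie_sub_bracket w u)
  + lie_sub_bracket w (lie_sub_bracket u v) = 0.
Proof. by apply: val_inj; rewrite /= lieb_jacobi. Qed.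

HB.instance Definition _ := isLieAlgebra.Build F lie_sub
  lie_sub_linearl lie_sub_linearr lie_subxx lie_sub_jacobi.

End IdealAsLieAlgebra.

Section QuotientLieAlgebra.
Variables (F : fieldType) (L : finDimLieAlgType F) (I : lie_ideal L).

Definition lie_quot : Type := Quotient.quot (lie_ideal_space I).
HB.instance Definition _ := GRing.Zmodule.on lie_quot.
HB.instance Definition _ := EqQuotient.on lie_quot.

Definition lie_proj (x : L) : lie_quot := \pi_lie_quot x.

Lemma lie_projP x y : reflect (lie_proj x = lie_proj y) (x - y \in I).
Proof.
by apply: (iffP idP); rewrite (Quotient.idealrBE (lie_ideal_space I)) => /eqP.
Qed.

Lemma lie_projK : cancel (repr : lie_quot -> L) lie_proj.
Proof. exact: reprK. Qed.

Lemma repr_lie_proj x : repr (lie_proj x) - x \in I.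
Proof. by apply/lie_projP; rewrite lie_projK. Qed.

Lemma lie_projD : {morph lie_proj : x y / x + y}.
Proof. exact: (@Quotient.pi_add L (lie_ideal_space I)). Qed.

Definition lie_quot_scale (a : F) (q : lie_quot) : lie_quot :=
  lie_proj (a *: repr q).

Fact lie_quot_scaleE a x : lie_quot_scale a (lie_proj x) = lie_proj (a *: x).
Proof. by apply/lie_projP; rewrite -scalerBr memvZ // repr_lie_proj. Qed.

Fact lie_quot_scalerA a b q :
  lie_quot_scale a (lie_quot_scale b q) = lie_quot_scale (a * b) q.
Proof. by rewrite -[q]lie_projK !lie_quot_scaleE scalerA. Qed.

Fact lie_quot_scale1r : left_id 1 lie_quot_scale.
Proof. by move=> q; rewrite -[q]lie_projK lie_quot_scaleE scale1r. Qed.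

Fact lie_quot_scalerDr : right_distributive lie_quot_scale +%R.
Proof.
move=> a p q; rewrite -[p]lie_projK -[q]lie_projK -lie_projD.
by rewrite !lie_quot_scaleE scalerDr lie_projD.
Qed.

Fact lie_quot_scalerDl q : {morph lie_quot_scale^~ q : a b / a + b}.
Proof.
by move=> a b; rewrite -[q]lie_projK !lie_quot_scaleE scalerDl lie_projD.
Qed.

HB.instance Definition _ := GRing.Zmodule_isLmodule.Build F lie_quot
  lie_quot_scalerA lie_quot_scale1r lie_quot_scalerDr lie_quot_scalerDl.

Lemma lie_projZ a x : lie_proj (a *: x) = a *: lie_proj x.
Proof. by rewrite -lie_quot_scaleE. Qed.

Fact lie_proj_is_linear : linear lie_proj.
Proof. by move=> a x y; rewrite lie_projD lie_projZ. Qed.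

Definition lie_quot_bracket (p q : lie_quot) : lie_quot :=
  lie_proj (lieb (repr p) (repr q)).

Fact lie_quot_bracketE x y :
  lie_quot_bracket (lie_proj x) (lie_proj y) = lie_proj (lieb x y).
Proof.
apply/lie_projP; set x' := repr _; set y' := repr _.
have -> : lieb x' y' - lieb x y = lieb x' (y' - y) + lieb (x' - x) y.
  by rewrite liebBr liebBl addrA subrK.
apply: memvD; first exact/lie_idealP/repr_lie_proj.
by rewrite liebC memvN; exact/lie_idealP/repr_lie_proj.
Qed.

Fact lie_quot_linearl q : linear (fun p => lie_quot_bracket p q).
Proof.
move=> a p r; rewrite -[p]lie_projK -[q]lie_projK -[r]lie_projK.
by rewrite -lie_proj_is_linear !lie_quot_bracketE lieb_linearl lie_proj_is_linear.
Qed.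

Fact lie_quot_linearr p : linear (lie_quot_bracket p).
Proof.
move=> a q r; rewrite -[p]lie_projK -[q]lie_projK -[r]lie_projK.
by rewrite -lie_proj_is_linear !lie_quot_bracketE lieb_linearr lie_proj_is_linear.
Qed.

Lemma lie_proj0 : lie_proj 0 = 0.
Proof. by rewrite -[0 in LHS](scale0r 0) lie_projZ scale0r. Qed.

Fact lie_quotxx p : lie_quot_bracket p p = 0.
Proof. by rewrite -[p]lie_projK lie_quot_bracketE liebxx lie_proj0. Qed.

Fact lie_quot_jacobi p q r :
  lie_quot_bracket p (lie_quot_bracket q r)
  + lie_quot_bracket q (lie_quot_bracket r p)
  + lie_quot_bracket r (lie_quot_bracket p q) = 0.
Proof.
rewrite -[p]lie_projK -[q]lie_projK -[r]lie_projK.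
by rewrite !lie_quot_bracketE -!lie_projD lieb_jacobi lie_proj0.
Qed.

HB.instance Definition _ := isLieAlgebra.Build F lie_quot
  lie_quot_linearl lie_quot_linearr lie_quotxx lie_quot_jacobi.

Lemma lie_proj_lieb : {morph lie_proj : x y / lieb x y}.
Proof. by move=> x y; rewrite -lie_quot_bracketE. Qed.

End QuotientLieAlgebra.

(* Main.v *)
Require Import Defs.
From HB Require Import structures.
From mathcomp Require Import all_boot all_order all_algebra.
From mathcomp Require Import classical_sets.

Import GRing.Theory.

(** Modulo [I], every [x : L] is a combination of brackets because [L / I] is
perfect ([lie_derived_lift]): such a combination lifts, term by term, to some
[y] in the derived algebra of [L].  The error [x - y] lies in [I], which is
perfect, so it is a combination of brackets of elements of [I]
([lie_derived_sub]); these are also brackets in [L].  Since the derived algebra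
is closed under addition ([linear_spanD]), it contains [x = (x - y) + y]. *)

Lemma linear_spanD (F : fieldType) (V : lmodType F) (A : set V) (x y : V) :
  linear_span A x -> linear_span A y -> linear_span A (x + y)%R.
Proof.
move=> [m [a [v [Av ->]]]] [n [b [w [Aw ->]]]].
exists (m + n).
exists (fun k => match split k with inl i => a i | inr j => b j end).
exists (fun k => match split k with inl i => v i | inr j => w j end).
split=> [k|]; first by case: (split k).
rewrite big_split_ord /=; congr (_ + _)%R; apply: eq_bigr => i _.
  by rewrite (unsplitK (inl i)).
by rewrite (unsplitK (inr i)).
Qed.

Lemma lie_derived_sub (F : fieldType) (L : finDimLieAlgType F)
    (I : lie_ideal L) (u : lie_sub I) :
  lie_derived (lie_sub I) u -> lie_derived L (vsval u).
Proof.
move=> [n [a [v [brv ->]]]]; exists n, a, (fun i => vsval (v i)); split.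
  by move=> i; have [x [y ->]] := brv i; exists (vsval x), (vsval y).
by rewrite linear_sum; apply: eq_bigr => i _; rewrite linearZ.
Qed.

(** The projection is a surjective morphism of Lie algebras, so choosing
representatives of both entries of each bracket lifts a combination of brackets
to one with the same coefficients. *)
Lemma lie_derived_lift (F : fieldType) (L : finDimLieAlgType F)
    (I : lie_ideal L) (q : lie_quot I) :
  lie_derived (lie_quot I) q -> exists2 y, lie_derived L y & lie_proj I y = q.
Proof.
move=> [n [a [v [brv ->]]]].
elim: n a v brv => [|n IHn] a v brv.
  exists 0%R; last by rewrite big_ord0 lie_proj0.
  by exists 0, (fun=> 0%R), (fun=> 0%R); split; [case | rewrite big_ord0].
have [y Dy projy] := IHn (fun i => a (lift ord0 i)) (fun i => v (lift ord0 i))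
  (fun i => brv (lift ord0 i)).
have [p [r v0E]] := brv ord0.
exists (a ord0 *: lieb (repr p) (repr r) + y)%R.
  apply: linear_spanD => //.
  exists 1, (fun=> a ord0), (fun=> lieb (repr p) (repr r)).
  by split=> [_|]; [exists (repr p), (repr r) | rewrite big_ord1].
by rewrite lie_proj_is_linear lie_proj_lieb !lie_projK projy big_ord_recl v0E.
Qed.

Theorem proposition2p4 (F : fieldType) (hF : real_or_complex F)
    (L : finDimLieAlgType F) (I : lie_ideal L)
    (hI : lie_perfect (lie_sub I)) (hLI : lie_perfect (lie_quot I)) :
  lie_perfect L.
Proof.
apply/seteqP; split=> // x _.
have [|y Dy projy] := @lie_derived_lift F L I (lie_proj I x).
  by rewrite hLI.
have xyI : (x - y)%R \in lie_ideal_space I by apply/lie_projP; rewrite projy.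
rewrite -(subrK y x); apply: linear_spanD => //.
by apply: (@lie_derived_sub F L I (Subvs xyI)); rewrite hI.
Qed.
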